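(* Let $\Lambda$ be a ring, let $\mathbf{C}:\cdots\to C_{n+1}\xrightarrow{d_{n+1}}C_n\xrightarrow{d_n}C_{n-1}\to\cdots$ be an arbitrary complex of left $\Lambda$-modules, and let $n$ be an integer. Write $H^n(\mathbf{C},-)$ for the functor $M\mapsto H^n(\mathrm{Hom}_\Lambda(\mathbf{C},M))$ from left $\Lambda$-modules to abelian groups. Then the right fundamental sequence of $H^n(\mathbf{C},-)$ is of the form $$0\to\overline{H^n(\mathbf{C},-)}\to H^n(\mathbf{C},-)\to\mathrm{Hom}_\Lambda(H_n(\mathbf{C}),-)\to\overline{H^n(\mathbf{C},-)}\circ\Sigma\to S^1(H^n(\mathbf{C},-))\to\mathrm{Ext}^1_\Lambda(H_n(\mathbf{C}),-)\to\overline{H^n(\mathbf{C},-)}\circ\Sigma^2\to S^2(H^n(\mathbf{C},-))\to\mathrm{Ext}^2_\Lambda(H_n(\mathbf{C}),-)\to\overline{H^n(\mathbf{C},-)}\circ\Sigma^3\to S^3(H^n(\mathbf{C},-))\to\cdots$$ (that is, $R^i(H^n(\mathbf{C},-))\simeq\mathrm{Ext}^i_\Lambda(H_n(\mathbf{C}),-)$ for $i\ge0$), where $\overline{H^n(\mathbf{C},-)}$ can be computed by the exact sequence of functors $$0\to(C_{n-1}/B_{n-1},-)\to(C_{n-1},-)\to(B_{n-1},-)\to\overline{H^n(\mathbf{C},-)}\to0$$ whose first maps are induced by the short exact sequence $0\to B_{n-1}\to C_{n-1}\to C_{n-1}/B_{n-1}\to0$. This sequence (the right fundamental sequence) is exact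 except, possibly, at the terms $\mathrm{Ext}^i_\Lambda(H_n(\mathbf{C}),-)$, $i\ge0$ (with $\mathrm{Ext}^0=\mathrm{Hom}$). If $H^n(\mathbf{C},-)$ is half-exact, then this sequence is exact.
   Context: $(A,-)$ denotes $\mathrm{Hom}_\Lambda(A,-)$; $B_k=\mathrm{Im}\,d_{k+1}$ denotes the boundaries of $\mathbf{C}$. A covariant additive functor $F$ is half-exact if for each short exact sequence $0\to A\to B\to C\to0$ the sequence $F(A)\to F(B)\to F(C)$ is exact at $F(B)$. Right fundamental sequence of an additive covariant functor $F$ from left $\Lambda$-modules to abelian groups. For a module $B$ choose an injective resolution $0\to B\to I^0\xrightarrow{d^0}I^1\xrightarrow{d^1}\cdots$. Put $\Sigma^0B=B$, let $m_0:B\to I^0$ be the given embedding, and for $i\ge0$ let $e_i:I^i\to\Sigma^{i+1}B$ be the cokernel of $m_i:\Sigma^iB\to I^i$ and $m_{i+1}:\Sigma^{i+1}B\to I^{i+1}$ the monomorphism with $d^i=m_{i+1}e_i$. Define $R^iF(B)=\mathrm{Ker}\,F(d^i)/\mathrm{Im}\,F(d^{i-1})$ (with $\mathrm{Im}\,F(d^{-1}):=0$); the sub-stabilization $\overline{F}(B)=\mathrm{Ker}(F(m_0):F(B)\to F(I^0))$, so that $(\overline{F}\circ\Sigma^i)(B)=\overline{F}(\Sigma^iB)=\mathrm{Ker}\,F(m_i)$ (well defined since $\overline{F}$ vanishes on injectives); the right satellites $S^0F=F$ and $S^iF(B)=\mathrm{Coker}(F(e_{i-1}):F(I^{i-1})\to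 F(\Sigma^iB))$ for $i\ge1$. The right fundamental sequence of $F$ is the sequence of functors $$0\to\overline{F}\to F\to R^0F\to\overline{F}\circ\Sigma\to S^1F\to R^1F\to\overline{F}\circ\Sigma^2\to S^2F\to R^2F\to\cdots$$ with maps, for $i\ge0$: $\overline{F}(\Sigma^iB)\to S^iF(B)$ the inclusion into $F(\Sigma^iB)$ followed by the projection; $S^iF(B)\to R^iF(B)$ induced by $F(m_i):F(\Sigma^iB)\to\mathrm{Ker}\,F(d^i)$; $R^iF(B)\to\overline{F}(\Sigma^{i+1}B)$ induced by $F(e_i)$. *)

(* Defs.v *)
From HB Require Import structures.
From mathcomp Require Import all_boot all_order all_algebra.
From mathcomp Require Import boolp.

Set Implicit Arguments.
Unset Strict Implicit.
Unset Printing Implicit Defensive.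
Import GRing.Theory Quotient.
Local Open Scope ring_scope.
Local Open Scope quotient_scope.
Lemma linear_ext (R : pzRingType) (U V : lmodType R) (f g : {linear U -> V}) :
  f =1 g -> f = g.
Proof.
case: f g => [f [[fB] [fZ]]] [g [[gB] [gZ]]] /= /funext e; subst g.
by rewrite (Prop_irrelevance fB gB) (Prop_irrelevance fZ gZ).
Qed.


Section KernelImage.
Variables (U V : zmodType) (f : {additive U -> V}).

Definition ker_pred : {pred U} := fun x => f x == 0.
Definition im_pred : {pred V} := fun y => `[< exists x, f x = y >].

Lemma ker_predP x : reflect (f x = 0) (x \in ker_pred).
Proof. exact: eqP. Qed.

Lemma im_predP y : reflect (exists x, f x = y) (y \in im_pred).
Proof. exact: asboolP. Qed.

Lemma im_predT x : f x \in im_pred.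
Proof. by apply/im_predP; exists x. Qed.

Fact ker_pred_closed : zmod_closed ker_pred.
Proof.
split=> [|x y /ker_predP x0 /ker_predP y0]; apply/ker_predP.
  exact: raddf0.
by rewrite raddfB /= x0 y0 subr0.
Qed.
HB.instance Definition _ := GRing.isZmodClosed.Build U ker_pred ker_pred_closed.

Fact im_pred_closed : zmod_closed im_pred.
Proof.
split=> [|_ _ /im_predP[x <-] /im_predP[y <-]]; apply/im_predP.
  by exists 0; rewrite raddf0.
by exists (x - y); rewrite raddfB.
Qed.
HB.instance Definition _ := GRing.isZmodClosed.Build V im_pred im_pred_closed.

Definition ker : Type := {x : U | x \in ker_pred}.
HB.instance Definition _ := [isSub of ker for @proj1_sig _ _].
HB.instance Definition _ := [Choice of ker by <:].
HB.instance Definition _ := [SubChoice_isSubZmodule of ker by <:].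

Definition coker : Type := {quot im_pred}.
HB.instance Definition _ := GRing.Zmodule.on coker.

Definition toker (x : U) (fx0 : f x = 0) : ker := Sub x (introT (ker_predP x) fx0).

Lemma kerP (x : ker) : f (val x) = 0. Proof. exact/ker_predP/valP. Qed.
End KernelImage.

Section Quot.
Variables (V W : zmodType) (I : zmodClosed V).

Lemma quot_eq (x y : V) : (\pi_{quot I} x == \pi_{quot I} y) = (x - y \in I).
Proof. by rewrite idealrBE. Qed.

Variable g : {additive V -> W}.

Definition quot_lift of (forall x, x \in I -> g x = 0) :=
  fun x : {quot I} => g (repr x).
Hypothesis g0 : forall x, x \in I -> g x = 0.

Lemma quot_lift_pi x : quot_lift g0 (\pi x) = g x.
Proof.
by apply/eqP; rewrite -subr_eq0 -raddfB g0 // -quot_eq reprK.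
Qed.

Fact quot_lift_additive : zmod_morphism (quot_lift g0).
Proof.
move=> x y; rewrite -[x]reprK -[y]reprK -raddfB !quot_lift_pi.
exact: raddfB.
Qed.
HB.instance Definition _ :=
  GRing.isZmodMorphism.Build {quot I} W (quot_lift g0) quot_lift_additive.
End Quot.


Section ModuleKernelImage.
Variables (R : pzRingType) (U V : lmodType R) (f : {linear U -> V}).

Fact ker_pred_scale : GRing.scaler_closed (ker_pred f).
Proof. by move=> a x /ker_predP x0; apply/ker_predP; rewrite /= linearZ /= x0 scaler0. Qed.
HB.instance Definition _ := GRing.isScaleClosed.Build R U (ker_pred f) ker_pred_scale.

Fact im_pred_scale : GRing.scaler_closed (im_pred f).
Proof. by move=> a _ /im_predP[x <-]; apply/im_predP; exists (a *: x); rewrite /= linearZ. Qed.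
HB.instance Definition _ := GRing.isScaleClosed.Build R V (im_pred f) im_pred_scale.
End ModuleKernelImage.

Section Submodule.
Variables (R : pzRingType) (V : lmodType R) (S : submodClosed V).

Definition submod : Type := {x : V | x \in (S : {pred V})}.
HB.instance Definition _ := [isSub of submod for @proj1_sig _ _].
HB.instance Definition _ := [Choice of submod by <:].
HB.instance Definition _ := [SubChoice_isSubLmodule of submod by <:].

Definition submod_incl : submod -> V := val.
HB.instance Definition _ := GRing.Linear.copy submod_incl (val : submod -> V).

Definition sub_pred : {pred V} := S.
Fact sub_pred_closed : zmod_closed sub_pred.
Proof. exact/GRing.subsemimod_closedB/GRing.subsemimodClosedP. Qed.
HB.instance Definition _ := GRing.isZmodClosed.Build V sub_pred sub_pred_closed.

Definition quotmod : Type := {quot sub_pred}.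
HB.instance Definition _ := GRing.Zmodule.on quotmod.

Definition quotmod_scale (a : R) (x : quotmod) : quotmod := \pi_{quot sub_pred} (a *: repr x).

Lemma quotmod_scale_pi a x : quotmod_scale a (\pi_{quot sub_pred} x) = \pi_{quot sub_pred} (a *: x).
Proof.
apply/eqP; rewrite quot_eq -scalerBr; apply: (@rpredZ _ _ S).
have: repr (\pi_{quot sub_pred} x) - x \in sub_pred; last by [].
by rewrite -quot_eq reprK.
Qed.

Lemma quotmod_repr (x : quotmod) : exists y, x = \pi_{quot sub_pred} y.
Proof. by exists (repr x); rewrite reprK. Qed.

Fact quotmod_scaleA a b (x : quotmod) :
  quotmod_scale a (quotmod_scale b x) = quotmod_scale (a * b) x.
Proof. by have [y ->] := quotmod_repr x; rewrite !quotmod_scale_pi scalerA. Qed.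
Fact quotmod_scale1 : left_id 1 quotmod_scale.
Proof. by move=> x; have [y ->] := quotmod_repr x; rewrite quotmod_scale_pi scale1r. Qed.
Fact quotmod_scaleDr : right_distributive quotmod_scale +%R.
Proof.
move=> a x y; have [x' ->] := quotmod_repr x; have [y' ->] := quotmod_repr y.
by rewrite -[LHS]/(quotmod_scale a (\pi x' + \pi y')) -raddfD
  !quotmod_scale_pi scalerDr raddfD.
Qed.
Fact quotmod_scaleDl (x : quotmod) : {morph quotmod_scale^~ x : a b / a + b}.
Proof.
move=> a b; have [y ->] := quotmod_repr x.
by rewrite !quotmod_scale_pi scalerDl raddfD.
Qed.
HB.instance Definition _ := GRing.Zmodule_isLmodule.Build R quotmod
  quotmod_scaleA quotmod_scale1 quotmod_scaleDr quotmod_scaleDl.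

Definition quotmod_proj (x : V) : quotmod := \pi_{quot sub_pred} x.
Fact quotmod_proj_linear : linear quotmod_proj.
Proof. by move=> a x y; rewrite /quotmod_proj raddfD /= -quotmod_scale_pi. Qed.
HB.instance Definition _ :=
  GRing.isLinear.Build R V quotmod *:%R quotmod_proj quotmod_proj_linear.

Lemma quotmod_surj (y : quotmod) : exists x, quotmod_proj x = y.
Proof. by exists (repr y); rewrite /quotmod_proj reprK. Qed.

Lemma quotmod_proj_eq0 x : quotmod_proj x = 0 <-> x \in S.
Proof.
have := quot_eq sub_pred x 0; rewrite subr0 raddf0 => e.
by split=> [/eqP|xS]; [rewrite e|apply/eqP; rewrite e].
Qed.

Section Lift.
Variables (W : lmodType R) (g : {linear V -> W}).
Definition quotmod_lift of (forall x, x \in S -> g x = 0) :=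
  fun x : quotmod => g (repr x).
Hypothesis g0 : forall x, x \in S -> g x = 0.
Lemma quotmod_liftE x : quotmod_lift g0 (quotmod_proj x) = g x.
Proof. exact: (@quot_lift_pi V W sub_pred g g0 x). Qed.
Fact quotmod_lift_linear : linear (quotmod_lift g0).
Proof.
move=> a x y; have [x' <-] := quotmod_surj x; have [y' <-] := quotmod_surj y.
by rewrite -linearP !quotmod_liftE linearP.
Qed.
HB.instance Definition _ :=
  GRing.isLinear.Build R quotmod W *:%R (quotmod_lift g0) quotmod_lift_linear.
End Lift.
End Submodule.

Section KerMap.
Variables (U V U' V' : zmodType) (g : {additive U -> V}) (g' : {additive U' -> V'}).
Variable a : {additive U -> U'}.

Definition ker_map (ga : forall x, g x = 0 -> g' (a x) = 0) (x : ker g) : ker g' :=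
  toker (ga _ (kerP x)).
Hypothesis ga : forall x, g x = 0 -> g' (a x) = 0.

Fact ker_map_additive : zmod_morphism (ker_map ga).
Proof. by move=> x y; apply: val_inj; rewrite /= raddfB. Qed.
HB.instance Definition _ :=
  GRing.isZmodMorphism.Build (ker g) (ker g') (ker_map ga) ker_map_additive.
End KerMap.

Section Corestriction.
Variables (U V W : zmodType) (a : {additive U -> V}) (g : {additive V -> W}).

Definition corestr (ga0 : forall x, g (a x) = 0) (x : U) : ker g := toker (ga0 x).
Hypothesis ga0 : forall x, g (a x) = 0.

Fact corestr_additive : zmod_morphism (corestr ga0).
Proof. by move=> x y; apply: val_inj; rewrite /= raddfB. Qed.
HB.instance Definition _ :=
  GRing.isZmodMorphism.Build U (ker g) (corestr ga0) corestr_additive.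
End Corestriction.

(* [subquot g S] is (Ker g) / (Ker g :&: S). *)
Section Subquotient.
Variables (V W : zmodType) (g : {additive V -> W}) (S : zmodClosed V).

Definition trace_pred : {pred ker g} := fun x => val x \in S.
Fact trace_pred_closed : zmod_closed trace_pred.
Proof.
split=> [|x y xS yS]; first by rewrite unfold_in /trace_pred raddf0 rpred0.
by rewrite unfold_in /trace_pred raddfB rpredB.
Qed.
HB.instance Definition _ :=
  GRing.isZmodClosed.Build (ker g) trace_pred trace_pred_closed.

Definition subquot : Type := {quot trace_pred}.
HB.instance Definition _ := GRing.Zmodule.on subquot.

Definition subq_class (x : ker g) : subquot := \pi_{quot trace_pred} x.
Fact subq_class_additive : zmod_morphism subq_class.
Proof. by move=> x y; rewrite /subq_class raddfB. Qed.
HB.instance Definition _ :=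
  GRing.isZmodMorphism.Build (ker g) subquot subq_class subq_class_additive.

Lemma subq_surj (y : subquot) : exists x, subq_class x = y.
Proof. by exists (repr y); rewrite /subq_class reprK. Qed.

Lemma subq_class_eq x y : subq_class x = subq_class y <-> val x - val y \in S.
Proof.
have := quot_eq trace_pred x y.
rewrite [X in _ = X]unfold_in /trace_pred raddfB => e.
by split=> [/eqP|h]; [rewrite e|apply/eqP; rewrite e].
Qed.

Lemma subq_class_eq0 x : subq_class x = 0 <-> val x \in S.
Proof.
have := subq_class_eq x 0; by rewrite !raddf0 addr0.
Qed.

Section Lift.
Variables (T : zmodType) (a : {additive ker g -> T}).
Definition subq_lift (aS : forall x : ker g, val x \in S -> a x = 0) : subquot -> T :=
  @quot_lift _ _ trace_pred a aS.
Hypothesis aS : forall x : ker g, val x \in S -> a x = 0.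
HB.instance Definition _ := GRing.Additive.copy (subq_lift aS) (@quot_lift _ _ trace_pred a aS).
Lemma subq_liftE x : subq_lift aS (subq_class x) = a x.
Proof. exact: (quot_lift_pi (g := a)). Qed.
End Lift.
End Subquotient.

Section SubquotientMap.
Variables (V W V' W' : zmodType) (g : {additive V -> W}) (g' : {additive V' -> W'}).
Variables (S : zmodClosed V) (S' : zmodClosed V') (a : {additive V -> V'}).
Hypothesis ga : forall x, g x = 0 -> g' (a x) = 0.

Definition subq_map_pre := subq_class S' \o ker_map ga.
HB.instance Definition _ := GRing.Additive.on subq_map_pre.

Hypothesis Sa : forall x, x \in S -> a x \in S'.
Fact subq_map_subproof x : val x \in S -> subq_map_pre x = 0.
Proof. by move=> xS; apply/subq_class_eq0/Sa. Qed.

Definition subq_map := subq_lift subq_map_subproof.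
HB.instance Definition _ := GRing.Additive.on subq_map.

Lemma subq_mapE x : subq_map (subq_class S x) = subq_class S' (ker_map ga x).
Proof. exact: subq_liftE. Qed.
End SubquotientMap.

Section CokerMap.
Variables (U V : zmodType) (f : {additive U -> V}).

Definition coker_proj (x : V) : coker f := \pi_{quot (im_pred f)} x.
Fact coker_proj_additive : zmod_morphism coker_proj.
Proof. by move=> x y; rewrite /coker_proj raddfB. Qed.
HB.instance Definition _ :=
  GRing.isZmodMorphism.Build V (coker f) coker_proj coker_proj_additive.

Lemma coker_surj (y : coker f) : exists x, coker_proj x = y.
Proof. by exists (repr y); rewrite /coker_proj reprK. Qed.

Lemma coker_proj_eq x y : coker_proj x = coker_proj y <-> x - y \in im_pred f.
Proof.
have e := quot_eq (im_pred f) x y.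
by split=> [/eqP|h]; [rewrite e|apply/eqP; rewrite e].
Qed.

Lemma coker_proj_eq0 x : coker_proj x = 0 <-> x \in im_pred f.
Proof. have := coker_proj_eq x 0; rewrite raddf0 subr0; exact. Qed.

Section Lift.
Variables (T : zmodType) (a : {additive V -> T}).
Definition coker_lift (aS : forall x, x \in im_pred f -> a x = 0) : coker f -> T :=
  @quot_lift _ _ (im_pred f) a aS.
Hypothesis aS : forall x, x \in im_pred f -> a x = 0.
HB.instance Definition _ := GRing.Additive.copy (coker_lift aS) (@quot_lift _ _ (im_pred f) a aS).
Lemma coker_liftE x : coker_lift aS (coker_proj x) = a x.
Proof. exact: (quot_lift_pi (g := a)). Qed.
End Lift.
End CokerMap.

Section Homology.
Variables (R : pzRingType) (U V W : lmodType R).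
Variables (f : {linear U -> V}) (g : {linear V -> W}).

Definition im_in_ker_pred : {pred submod (ker_pred g)} := fun x => val x \in im_pred f.
Fact im_in_ker_closed : GRing.subsemimod_closed im_in_ker_pred.
Proof.
split; first split.
- by rewrite unfold_in /im_in_ker_pred raddf0 rpred0.
- by move=> x y xS yS; rewrite unfold_in /im_in_ker_pred raddfD rpredD.
by move=> a x xS; rewrite unfold_in /im_in_ker_pred linearZ rpredZ.
Qed.
HB.instance Definition _ := GRing.isSubmodClosed.Build R _ im_in_ker_pred im_in_ker_closed.

(* (Ker g) / (Ker g :&: Im f) *)
Definition homology : lmodType R := quotmod im_in_ker_pred.
End Homology.

Section Hom.
Variables (R : pzRingType) (U V : lmodType R).

Definition hom : Type := {linear U -> V}.
HB.instance Definition _ := gen_eqMixin hom.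
HB.instance Definition _ := gen_choiceMixin hom.

Definition hom_zero : hom := \0 : {linear U -> V}.
Definition hom_add (f g : hom) : hom := f \+ g : {linear U -> V}.
Definition hom_opp (f : hom) : hom := \- f : {linear U -> V}.

Fact hom_addA : associative hom_add.
Proof. by move=> f g h; apply: linear_ext => x /=; rewrite addrA. Qed.
Fact hom_addC : commutative hom_add.
Proof. by move=> f g; apply: linear_ext => x /=; rewrite addrC. Qed.
Fact hom_add0 : left_id hom_zero hom_add.
Proof. by move=> f; apply: linear_ext => x /=; rewrite add0r. Qed.
Fact hom_addN : left_inverse hom_zero hom_opp hom_add.
Proof. by move=> f; apply: linear_ext => x /=; rewrite addNr. Qed.
HB.instance Definition _ :=
  GRing.isZmodule.Build hom hom_addA hom_addC hom_add0 hom_addN.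
End Hom.

Section HomMaps.
Variables (R : pzRingType).

Definition postcomp (A M N : lmodType R) (f : {linear M -> N}) (g : hom A M) : hom A N :=
  f \o (g : {linear A -> M}).
Fact postcomp_additive A M N f : zmod_morphism (@postcomp A M N f).
Proof. by move=> g h; apply: linear_ext => x /=; rewrite raddfB. Qed.
HB.instance Definition _ A M N f :=
  GRing.isZmodMorphism.Build _ _ (@postcomp A M N f) (postcomp_additive f).

Definition precomp (A B M : lmodType R) (h : {linear A -> B}) (g : hom B M) : hom A M :=
  (g : {linear B -> M}) \o h.
Fact precomp_additive A B M h : zmod_morphism (@precomp A B M h).
Proof. by move=> g k; apply: linear_ext. Qed.
HB.instance Definition _ A B M h :=
  GRing.isZmodMorphism.Build _ _ (@precomp A B M h) (precomp_additive h).
End HomMaps.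

Record addFunctor (R : pzRingType) := AddFunctor {
  fobj :> lmodType R -> zmodType;
  fmap : forall M N : lmodType R, {linear M -> N} -> {additive fobj M -> fobj N};
  fmap1 : forall (M : lmodType R) (x : fobj M), fmap (idfun : {linear M -> M}) x = x;
  fmap_comp : forall (M N P : lmodType R) (g : {linear N -> P}) (f : {linear M -> N})
    (x : fobj M), fmap (g \o f : {linear M -> P}) x = fmap g (fmap f x);
  fmapD : forall (M N : lmodType R) (f g : {linear M -> N}) (x : fobj M),
    fmap (f \+ g : {linear M -> N}) x = fmap f x + fmap g x
}.

Record natTrans (R : pzRingType) (F G : addFunctor R) := NatTrans {
  nt_map :> forall M : lmodType R, {additive F M -> G M};
  nt_natural : forall (M N : lmodType R) (f : {linear M -> N}) (x : F M),
    nt_map N (fmap F f x) = fmap G f (nt_map M x)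
}.

Record natIso (R : pzRingType) (F G : addFunctor R) := NatIso {
  iso_to : natTrans F G;
  iso_from : natTrans G F;
  iso_toK : forall M : lmodType R, cancel (iso_to M) (iso_from M);
  iso_fromK : forall M : lmodType R, cancel (iso_from M) (iso_to M)
}.

Definition nt_comp_map (R : pzRingType) (F G H : addFunctor R)
  (b : natTrans G H) (a : natTrans F G) (M : lmodType R) : {additive F M -> H M} :=
  b M \o a M.

Definition nt_comp (R : pzRingType) (F G H : addFunctor R)
  (b : natTrans G H) (a : natTrans F G) : natTrans F H.
Proof.
exists (nt_comp_map b a) => M N f x.
by rewrite /= !nt_natural.
Defined.

Section ExactFunctors.
Variables (R : pzRingType) (F G H : addFunctor R).

Definition nt_mono (a : natTrans F G) := forall M : lmodType R, injective (a M).
Definition nt_epi (a : natTrans F G) :=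
  forall (M : lmodType R) (y : G M), exists x, a M x = y.
Definition nt_exact (a : natTrans F G) (b : natTrans G H) :=
  forall (M : lmodType R) (y : G M), b M y = 0 <-> exists x, a M x = y.
End ExactFunctors.

Definition half_exact (R : pzRingType) (F : addFunctor R) :=
  forall (A B C : lmodType R) (f : {linear A -> B}) (g : {linear B -> C}),
    injective f -> (forall y, g y = 0 <-> exists x, f x = y) ->
    (forall z, exists y, g y = z) ->
    forall y : F B, fmap F g y = 0 <-> exists x, fmap F f x = y.

Section FunctorTheory.
Variables (R : pzRingType) (F : addFunctor R).

Lemma fmap_ext (M N : lmodType R) (f g : {linear M -> N}) : f =1 g -> fmap F f =1 fmap F g.
Proof. by move=> /linear_ext ->. Qed.

Lemma fmap0 (M N : lmodType R) (f : {linear M -> N}) :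
  (forall x, f x = 0) -> forall x, fmap F f x = 0.
Proof.
move=> f0 x; apply: (addrI (fmap F f x)); rewrite -fmapD addr0.
by apply: fmap_ext => y /=; rewrite f0 addr0.
Qed.

Lemma fmap_sqr (M N P Q : lmodType R) (g : {linear N -> P}) (f : {linear M -> N})
  (g' : {linear Q -> P}) (f' : {linear M -> Q}) x :
  (forall y, g (f y) = g' (f' y)) -> fmap F g (fmap F f x) = fmap F g' (fmap F f' x).
Proof. by move=> e; rewrite -!fmap_comp; apply: fmap_ext => y /=. Qed.

Lemma fmap_im (M N P : lmodType R) (g : {linear N -> P}) (f : {linear M -> N})
  (h : {linear M -> P}) x :
  (forall y, g (f y) = h y) -> fmap F g (fmap F f x) = fmap F h x.
Proof. by move=> e; rewrite -fmap_comp; apply: fmap_ext. Qed.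
End FunctorTheory.

Definition homF (R : pzRingType) (A : lmodType R) : addFunctor R.
Proof.
exists (fun M => hom A M : zmodType) (fun M N f => @postcomp R A M N f).
- by move=> M f; apply: linear_ext.
- by move=> M N P g f x; apply: linear_ext.
- by move=> M N f g x; apply: linear_ext.
Defined.

Definition homF_map (R : pzRingType) (A B : lmodType R) (h : {linear A -> B}) :
  natTrans (homF B) (homF A).
Proof.
exists (fun M => @precomp R A B M h : {additive hom B M -> hom A M}) => M N f g.
exact: linear_ext.
Defined.

(* Differentials are given between any two degrees, to avoid casts between
   C (n - 1 + 1) and C n; only the d_(j+1) : C (j+1) -> C j can be nonzero. *)
Record complex (R : pzRingType) := Complex {
  cpx :> int -> lmodType R;
  diff : forall i j : int, {linear cpx i -> cpx j};
  diff_shape : forall i j : int, i != j + 1 -> forall x, diff i j x = 0;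
  diff_diff : forall (i j k : int) (x : cpx i), diff j k (diff i j x) = 0
}.

Section ComplexDefs.
Variables (R : pzRingType) (C : complex R) (n : int).

Definition boundaries : lmodType R := submod (im_pred (diff C (n + 1) n)).
Definition boundaries_incl : {linear boundaries -> C n} := @submod_incl _ _ _.
Definition mod_boundaries : lmodType R := quotmod (im_pred (diff C (n + 1) n)).
Definition mod_boundaries_proj : {linear C n -> mod_boundaries} := @quotmod_proj _ _ _.
Definition homologyC : lmodType R := homology (diff C (n + 1) n) (diff C n (n - 1)).

(* The degree n part of Hom(C, M) is Hom(C_n, M). *)
Definition cohom_obj (M : lmodType R) : zmodType :=
  subquot (@precomp _ _ _ M (diff C (n + 1) n)) (im_pred (@precomp _ _ _ M (diff C n (n - 1)))).

Fact cohom_ker (M N : lmodType R) (f : {linear M -> N}) (x : hom (C n) M) :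
  precomp (diff C (n + 1) n) x = 0 -> precomp (diff C (n + 1) n) (postcomp f x) = 0.
Proof.
move=> x0; have -> : precomp (diff C (n + 1) n) (postcomp f x) =
  postcomp f (precomp (diff C (n + 1) n) x) by exact: linear_ext.
rewrite x0.
exact: raddf0.
Qed.

Fact cohom_im (M N : lmodType R) (f : {linear M -> N}) (x : hom (C n) M) :
  x \in im_pred (@precomp _ _ _ M (diff C n (n - 1))) ->
  postcomp f x \in im_pred (@precomp _ _ _ N (diff C n (n - 1))).
Proof.
by move=> /im_predP[y <-]; apply/im_predP; exists (postcomp f y); apply: linear_ext.
Qed.

Definition cohomF : addFunctor R.
Proof.
exists cohom_obj (fun M N f => subq_map (@cohom_ker M N f) (@cohom_im M N f)).
- move=> M x; have [y <-] := subq_surj x; rewrite /= subq_mapE.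
  by congr subq_class; apply: val_inj; apply: linear_ext.
- move=> M N P g f x; have [y <-] := subq_surj x; rewrite /= !subq_mapE.
  by congr subq_class; apply: val_inj; apply: linear_ext.
- move=> M N f g x; have [y <-] := subq_surj x; rewrite /= !subq_mapE -raddfD.
  by congr subq_class; apply: val_inj; apply: linear_ext.
Defined.
End ComplexDefs.

Definition injective_module (R : pzRingType) (E : lmodType R) :=
  forall (A B : lmodType R) (i : {linear A -> B}) (f : {linear A -> E}),
    injective i -> exists g : {linear B -> E}, forall a, g (i a) = f a.

Record injRes (R : pzRingType) (B : lmodType R) := InjRes {
  res_mod :> nat -> lmodType R;
  res_diff : forall i : nat, {linear res_mod i -> res_mod i.+1};
  res_aug : {linear B -> res_mod 0};
  res_injective : forall i : nat, injective_module (res_mod i);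
  res_aug_inj : injective res_aug;
  res_exact0 : forall y : res_mod 0,
    res_diff 0 y = 0 <-> exists x, res_aug x = y;
  res_exactS : forall (i : nat) (y : res_mod i.+1),
    res_diff i.+1 y = 0 <-> exists x, res_diff i x = y
}.

Section Cosyzygies.
Variables (R : pzRingType) (B : lmodType R) (I : injRes B).

Record cosyzygy (i : nat) := Cosyzygy {
  cz_mod : lmodType R;
  cz_mono : {linear cz_mod -> I i};
  cz_inj : injective cz_mono;
  cz_im : forall y : I i, res_diff I i y = 0 <-> exists x, cz_mono x = y
}.

Section Step.
Variables (i : nat) (z : cosyzygy i).

Fact cz_next_subproof x : x \in im_pred (cz_mono z) -> res_diff I i x = 0.
Proof. by move=> /im_predP h; apply/(cz_im z). Qed.

Definition cz_next_mod : lmodType R := quotmod (im_pred (cz_mono z)).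
Definition cz_next_mono : {linear cz_next_mod -> I i.+1} :=
  quotmod_lift cz_next_subproof.

Lemma cz_next_monoE x : cz_next_mono (quotmod_proj _ x) = res_diff I i x.
Proof. exact: quotmod_liftE. Qed.

Fact cz_next_inj : injective cz_next_mono.
Proof.
apply: raddf_inj => x; have [y <-] := quotmod_surj x.
move=> e; apply/quotmod_proj_eq0/im_predP/(cz_im z).
by rewrite -cz_next_monoE.
Qed.

Fact cz_next_im (y : I i.+1) :
  res_diff I i.+1 y = 0 <-> exists x, cz_next_mono x = y.
Proof.
split=> [/res_exactS[x <-]|[x <-]].
  by exists (quotmod_proj _ x); exact: cz_next_monoE.
have [x' <-] := quotmod_surj x; apply/res_exactS; exists x'.
by rewrite -cz_next_monoE.
Qed.
End Step.

(* [cosyz i] is Sigma^i B together with m_i : Sigma^i B -> I^i; Sigma^0 B is B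
   and Sigma^(i+1) B is the cokernel of m_i. *)
Fixpoint cosyz (i : nat) : cosyzygy i :=
  match i with
  | 0 => Cosyzygy (@res_aug_inj R B I) (@res_exact0 R B I)
  | j.+1 => Cosyzygy (@cz_next_inj j (cosyz j)) (@cz_next_im j (cosyz j))
  end.

Definition Sigma (i : nat) : lmodType R := cz_mod (cosyz i).
Definition res_mono (i : nat) : {linear Sigma i -> I i} := cz_mono (cosyz i).
Definition res_epi (i : nat) : {linear I i -> Sigma i.+1} :=
  @quotmod_proj _ _ (im_pred (res_mono i)).

Lemma res_mono_inj i : injective (res_mono i). Proof. exact: cz_inj. Qed.

Lemma res_mono_epi i x : res_mono i.+1 (res_epi i x) = res_diff I i x.
Proof. exact: quotmod_liftE. Qed.

Lemma res_epi_surj i (y : Sigma i.+1) : exists x, res_epi i x = y.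
Proof. exact: quotmod_surj. Qed.

Lemma res_epi_mono i x : res_epi i (res_mono i x) = 0.
Proof. by apply/quotmod_proj_eq0/im_predP; exists x. Qed.
End Cosyzygies.

Section Comparison.
Variables (R : pzRingType) (B B' : lmodType R) (f : {linear B -> B'}).
Variables (I : injRes B) (I' : injRes B').

Record compar := Compar {
  cmp_sig : forall i : nat, {linear Sigma I i -> Sigma I' i};
  cmp_res : forall i : nat, {linear I i -> I' i};
  cmp_sig0 : forall x : B, cmp_sig 0 x = f x;
  cmp_mono : forall (i : nat) (x : Sigma I i),
    cmp_res i (res_mono I i x) = res_mono I' i (cmp_sig i x);
  cmp_epi : forall (i : nat) (y : I i),
    cmp_sig i.+1 (res_epi I i y) = res_epi I' i (cmp_res i y)
}.

Section LiftStep.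
Variables (i : nat) (s : {linear Sigma I i -> Sigma I' i}).

Fact lift_res_ex : exists g : {linear I i -> I' i},
  forall a, g (res_mono I i a) = res_mono I' i (s a).
Proof.
exact: (@res_injective _ _ I' i _ _ (res_mono I i)
  (res_mono I' i \o s : {linear _ -> _}) (@res_mono_inj _ _ I i)).
Qed.
Definition lift_res : {linear I i -> I' i} := projT1 (cid lift_res_ex).

Fact lift_sig_subproof x :
  x \in im_pred (res_mono I i) -> (res_epi I' i \o lift_res) x = 0.
Proof.
move=> /im_predP[y <-] /=.
by rewrite /lift_res; case: cid => g /= ->; rewrite res_epi_mono.
Qed.
Definition lift_sig : {linear Sigma I i.+1 -> Sigma I' i.+1} :=
  quotmod_lift lift_sig_subproof.
End LiftStep.

Fixpoint lift_sigs (i : nat) : {linear Sigma I i -> Sigma I' i} :=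
  match i with
  | 0 => f
  | j.+1 => lift_sig (lift_sigs j)
  end.

Definition lift_compar : compar.
Proof.
exists lift_sigs (fun i => lift_res (lift_sigs i)) => //.
- by move=> i x; rewrite /lift_res; case: cid.
- by move=> i y; exact: quotmod_liftE.
Defined.

(* Two comparisons over the same map are homotopic. *)
Section Homotopy.
Variables (k k' : compar).

Definition factors i (h : {linear I i -> Sigma I' i}) :=
  forall x, cmp_sig k i x - cmp_sig k' i x = h (res_mono I i x).

Lemma factors0 : factors (\0 : {linear I 0 -> Sigma I' 0}).
Proof. by move=> x; rewrite [cmp_sig k 0 x]cmp_sig0 [cmp_sig k' 0 x]cmp_sig0 subrr. Qed.

Lemma factorsS i h : @factors i h ->
  exists t : {linear I i.+1 -> I' i},
    (forall x, cmp_res k i x - cmp_res k' i x =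
       res_mono I' i (h x) + t (res_diff I i x)) /\
    factors (res_epi I' i \o t : {linear _ -> _}).
Proof.
move=> hP.
pose g : {linear I i -> I' i} :=
  (cmp_res k i \+ \- cmp_res k' i) \+ \- (res_mono I' i \o h).
have g0 x : x \in im_pred (res_mono I i) -> g x = 0.
  move=> /im_predP[y <-] /=.
  by rewrite !cmp_mono -hP raddfB /= subrr.
have [t tP] := @res_injective _ _ I' i _ _ (res_mono I i.+1)
  (quotmod_lift g0 : {linear Sigma I i.+1 -> I' i}) (@res_mono_inj _ _ I i.+1).
have tE x : t (res_diff I i x) = g x.
  by rewrite -res_mono_epi tP; exact: quotmod_liftE.
have e x : cmp_res k i x - cmp_res k' i x =
    res_mono I' i (h x) + t (res_diff I i x).
  by rewrite tE /= [RHS]addrC subrK.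
exists t; split=> // x; have [y <-] := res_epi_surj x.
by rewrite !cmp_epi -raddfB e raddfD /= res_epi_mono add0r res_mono_epi.
Qed.

Lemma factors_ex i : match i return Prop with
  | 0 => True
  | j.+1 => exists t : {linear I j.+1 -> I' j},
              factors (res_epi I' j \o t : {linear _ -> _})
  end.
Proof.
elim: i => [//|[_|j [t /factorsS[t' [_ t'P]]]]]; last by exists t'.
by have [t [_ tP]] := factorsS factors0; exists t.
Qed.

Variable F : addFunctor R.

Lemma fmap_factors i h (x : F (Sigma I i)) : factors h ->
  fmap F (cmp_sig k i) x = fmap F (cmp_sig k' i) x + fmap F h (fmap F (res_mono I i) x).
Proof.
move=> hP; rewrite -fmap_comp -fmapD; apply: fmap_ext => y /=.
by rewrite -hP addrC subrK.
Qed.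

Lemma fmap_sig_ker i (x : F (Sigma I i)) : fmap F (res_mono I i) x = 0 ->
  fmap F (cmp_sig k i) x = fmap F (cmp_sig k' i) x.
Proof.
case: i x => [|i] x x0.
  by rewrite (fmap_factors _ factors0) x0 raddf0 addr0.
by have [t /fmap_factors ->] := factors_ex i.+1; rewrite x0 raddf0 addr0.
Qed.

Lemma fmap_sig_coker i (x : F (Sigma I i.+1)) :
  fmap F (cmp_sig k i.+1) x - fmap F (cmp_sig k' i.+1) x
    \in im_pred (fmap F (res_epi I' i)).
Proof.
have [t /fmap_factors ->] := factors_ex i.+1.
by rewrite addrC addKr fmap_comp im_predT.
Qed.
End Homotopy.
End Comparison.

(* Boundaries of the complex F(I), with Im F(d^{-1}) = 0. *)
Section Coboundaries.
Variables (R : pzRingType) (F : addFunctor R) (B : lmodType R) (I : injRes B).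

Definition cobd (i : nat) : {pred F (I i)} :=
  match i return {pred F (I i)} with
  | 0 => fun x => x == 0
  | j.+1 => im_pred (fmap F (res_diff I j))
  end.
Arguments cobd : clear implicits.

Fact cobd_closed i : zmod_closed (cobd i).
Proof.
case: i => [|i]; last exact: im_pred_closed.
split; first exact: eqxx.
by move=> x y /eqP -> /eqP ->; rewrite subr0; exact: eqxx.
Qed.
HB.instance Definition _ i := GRing.isZmodClosed.Build _ (cobd i) (cobd_closed i).
End Coboundaries.
Arguments cobd {R} F {B} I i.

Section FmapRes.
Variables (R : pzRingType) (F : addFunctor R) (B B' : lmodType R) (f : {linear B -> B'}).
Variables (I : injRes B) (I' : injRes B').

Lemma fmap_mono0 (k : compar f I I') i (x : F (Sigma I i)) :
  fmap F (res_mono I i) x = 0 ->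
  fmap F (res_mono I' i) (fmap F (cmp_sig k i) x) = 0.
Proof.
move=> x0; rewrite -(fmap_sqr (f := res_mono I i) (g := cmp_res k i)).
  by rewrite x0 raddf0.
by move=> y; rewrite cmp_mono.
Qed.

Lemma cmp_diff (k : compar f I I') i (x : I i) :
  cmp_res k i.+1 (res_diff I i x) = res_diff I' i (cmp_res k i x).
Proof. by rewrite -!res_mono_epi cmp_mono cmp_epi. Qed.

Lemma fmap_diff0 (k : compar f I I') i (x : F (I i)) :
  fmap F (res_diff I i) x = 0 ->
  fmap F (res_diff I' i) (fmap F (cmp_res k i) x) = 0.
Proof.
move=> x0; rewrite -(fmap_sqr (f := res_diff I i) (g := cmp_res k i.+1)).
  by rewrite x0 raddf0.
by move=> y; rewrite cmp_diff.
Qed.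

Lemma fmap_epi_im (k : compar f I I') i (x : F (Sigma I i.+1)) :
  x \in im_pred (fmap F (res_epi I i)) ->
  fmap F (cmp_sig k i.+1) x \in im_pred (fmap F (res_epi I' i)).
Proof.
move=> /im_predP[y <-]; apply/im_predP; exists (fmap F (cmp_res k i) y).
by apply: fmap_sqr => z; rewrite cmp_epi.
Qed.

Lemma fmap_cobd (k : compar f I I') i (x : F (I i)) :
  x \in cobd F I i -> fmap F (cmp_res k i) x \in cobd F I' i.
Proof.
case: i x => [|i] x; first by move=> /eqP ->; rewrite raddf0 rpred0.
move=> /im_predP[y <-]; apply/im_predP; exists (fmap F (cmp_res k i) y).
by apply: fmap_sqr => z; rewrite cmp_diff.
Qed.

Lemma fmap_res_cobd (k k' : compar f I I') i (x : F (I i)) :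
  fmap F (res_diff I i) x = 0 ->
  fmap F (cmp_res k i) x - fmap F (cmp_res k' i) x \in cobd F I' i.
Proof.
have D (h : {linear I i -> Sigma I' i}) (t : {linear I i.+1 -> I' i}) :
    (forall x, cmp_res k i x - cmp_res k' i x =
       res_mono I' i (h x) + t (res_diff I i x)) ->
    fmap F (res_diff I i) x = 0 ->
    fmap F (cmp_res k i) x - fmap F (cmp_res k' i) x =
    fmap F (res_mono I' i) (fmap F h x).
  move=> e x0; apply/eqP; rewrite subr_eq -[X in X + _]addr0.
  rewrite -[X in _ + X + _](raddf0 (fmap F t)) -x0 -!fmap_comp -!fmapD.
  by apply/eqP/fmap_ext => y /=; rewrite -e subrK.
case: i x D => [|i] x D x0.
  have [t [tP _]] := factorsS (factors0 k k').
  by rewrite (D _ _ tP x0) (fmap0 (f := \0)) // raddf0 rpred0.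
have [t0 /factorsS[t [tP _]]] := factors_ex k k' i.+1.
rewrite (D _ _ tP x0); apply/im_predP; exists (fmap F t0 x).
by rewrite -!fmap_comp; apply: fmap_ext => y /=; rewrite res_mono_epi.
Qed.
End FmapRes.

Section ComparConstructions.
Variables (R : pzRingType).

Definition compar1 (B : lmodType R) (I : injRes B) : compar (idfun : {linear B -> B}) I I.
Proof. by exists (fun i => idfun : {linear _ -> _}) (fun i => idfun : {linear _ -> _}). Defined.

Definition compar_comp (B B' B'' : lmodType R) (g : {linear B' -> B''})
  (f : {linear B -> B'}) (I : injRes B) (I' : injRes B') (I'' : injRes B'')
  (l : compar g I' I'') (k : compar f I I') :
  compar (g \o f : {linear B -> B''}) I I''.
Proof.
exists (fun i => cmp_sig l i \o cmp_sig k i : {linear _ -> _})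
       (fun i => cmp_res l i \o cmp_res k i : {linear _ -> _}).
- by move=> x; rewrite /= (cmp_sig0 k) (cmp_sig0 l).
- by move=> i x; rewrite /= !cmp_mono.
- by move=> i x; rewrite /= !cmp_epi.
Defined.

Definition comparD (B B' : lmodType R) (f g : {linear B -> B'})
  (I : injRes B) (I' : injRes B') (k : compar f I I') (l : compar g I I') :
  compar (f \+ g : {linear B -> B'}) I I'.
Proof.
exists (fun i => cmp_sig k i \+ cmp_sig l i : {linear _ -> _})
       (fun i => cmp_res k i \+ cmp_res l i : {linear _ -> _}).
- by move=> x; rewrite /= (cmp_sig0 k) (cmp_sig0 l).
- by move=> i x; rewrite /= !cmp_mono raddfD.
- by move=> i x; rewrite /= !cmp_epi raddfD.
Defined.
End ComparConstructions.

(* The functors of the right fundamental sequence.  [res] chooses an injective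
   resolution of every module; the action on morphisms uses chosen lifts and is
   independent of them by [fmap_sig_ker], [fmap_sig_coker] and [fmap_res_cobd]. *)

Section FundamentalSequence.
Variables (R : pzRingType) (res : forall B : lmodType R, injRes B).
Variable F : addFunctor R.

Let lft (M N : lmodType R) (f : {linear M -> N}) := lift_compar f (res M) (res N).

(* \overline{F} \o Sigma^i, that is B |-> Ker F(m_i) *)
Definition substabF (i : nat) : addFunctor R.
Proof.
exists (fun B => ker (fmap F (res_mono (res B) i)) : zmodType)
  (fun M N f => ker_map (@fmap_mono0 _ F _ _ _ _ _ (lft f) i)).
- move=> M x; apply: val_inj.
  exact: etrans (fmap_sig_ker (lft idfun) (compar1 (res M)) (kerP x)) (fmap1 _).
- move=> M N P g f x; apply: val_inj.
  apply: etrans (fmap_sig_ker (lft (g \o f)) (compar_comp (lft g) (lft f)) (kerP x)) _.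
  exact: fmap_comp.
- move=> M N f g x; apply: val_inj.
  apply: etrans (fmap_sig_ker (lft (f \+ g)) (comparD (lft f) (lft g)) (kerP x)) _.
  exact: fmapD.
Defined.

Section SatelliteMap.
Variables (j : nat) (M N : lmodType R) (f : {linear M -> N}).
Definition satellite_pre : F (Sigma (res M) j.+1) -> coker (fmap F (res_epi (res N) j)) :=
  @coker_proj _ _ (fmap F (res_epi (res N) j)) \o fmap F (cmp_sig (lft f) j.+1).
HB.instance Definition _ := GRing.Additive.on satellite_pre.
Fact satellite_subproof x :
  x \in im_pred (fmap F (res_epi (res M) j)) -> satellite_pre x = 0.
Proof. by move=> xI; apply/coker_proj_eq0/fmap_epi_im. Qed.
Definition satellite_map : {additive coker (fmap F (res_epi (res M) j)) ->
    coker (fmap F (res_epi (res N) j))} := coker_lift satellite_subproof.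
Lemma satellite_mapE x :
  satellite_map (coker_proj _ x) = coker_proj _ (fmap F (cmp_sig (lft f) j.+1) x).
Proof. exact: (coker_liftE satellite_subproof). Qed.
End SatelliteMap.

Definition satelliteS (j : nat) : addFunctor R.
Proof.
exists (fun B => coker (fmap F (res_epi (res B) j)) : zmodType) (@satellite_map j).
- move=> M x; have [y <-] := coker_surj x.
  rewrite satellite_mapE -[in RHS](fmap1 y); apply/coker_proj_eq.
  exact: (fmap_sig_coker (lft idfun) (compar1 (res M)) y).
- move=> M N P g f x; have [y <-] := coker_surj x.
  rewrite (satellite_mapE f) (satellite_mapE g) satellite_mapE.
  rewrite -[X in _ = coker_proj _ X]fmap_comp; apply/coker_proj_eq.
  exact: (fmap_sig_coker (lft (g \o f)) (compar_comp (lft g) (lft f)) y).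
- move=> M N f g x; have [y <-] := coker_surj x.
  rewrite !satellite_mapE -raddfD -fmapD; apply/coker_proj_eq.
  exact: (fmap_sig_coker (lft (f \+ g)) (comparD (lft f) (lft g)) y).
Defined.

(* S^i F: F itself for i = 0, and B |-> Coker F(e_(i-1)) for i > 0 *)
Definition satelliteF (i : nat) : addFunctor R :=
  match i with 0 => F | j.+1 => satelliteS j end.

Section DerivedMap.
Variables (i : nat) (M N : lmodType R) (f : {linear M -> N}).
Definition derived_obj (B : lmodType R) : zmodType :=
  subquot (fmap F (res_diff (res B) i)) (cobd F (res B) i).
Definition derived_class (B : lmodType R) :
  {additive ker (fmap F (res_diff (res B) i)) -> derived_obj B} := @subq_class _ _ _ _.
Definition derived_map : {additive derived_obj M -> derived_obj N} :=
  subq_map (@fmap_diff0 _ F _ _ _ _ _ (lft f) i) (@fmap_cobd _ F _ _ _ _ _ (lft f) i).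
Lemma derived_mapE x : derived_map (derived_class M x) =
  derived_class N (ker_map (@fmap_diff0 _ F _ _ _ _ _ (lft f) i) x).
Proof. exact: subq_mapE. Qed.
Lemma derived_surj B (y : derived_obj B) : exists x, derived_class B x = y.
Proof. exact: subq_surj. Qed.
End DerivedMap.

(* R^i F: B |-> Ker F(d^i) / Im F(d^(i-1)) *)
Definition derivedF (i : nat) : addFunctor R.
Proof.
exists (derived_obj i) (@derived_map i).
- move=> M x; have [y <-] := derived_surj x; rewrite derived_mapE.
  apply/subq_class_eq; rewrite -[X in _ - X]fmap1.
  exact: (fmap_res_cobd (lft idfun) (compar1 (res M)) (kerP y)).
- move=> M N P g f x; have [y <-] := derived_surj x.
  rewrite (derived_mapE f) (derived_mapE g) derived_mapE.
  apply/subq_class_eq; rewrite [X in _ - X]/= -[X in _ - X]fmap_comp.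
  exact: (fmap_res_cobd (lft (g \o f)) (compar_comp (lft g) (lft f)) (kerP y)).
- move=> M N f g x; have [y <-] := derived_surj x; rewrite !derived_mapE -raddfD.
  apply/subq_class_eq.
  have := fmap_res_cobd (lft (f \+ g)) (comparD (lft f) (lft g)) (kerP y).
  by rewrite [X in _ - X]fmapD.
Defined.

Definition substab_to_satellite (i : nat) : natTrans (substabF i) (satelliteF i).
Proof.
case: i => [|j].
  exists (fun B => val : {additive ker (fmap F (res_mono (res B) 0)) -> F B}).
  by move=> M N f x; exact: (@fmap_ext _ F _ _ (cmp_sig (lft f) 0) f (cmp_sig0 (lft f)) (val x)).
exists (fun B => @coker_proj _ _ (fmap F (res_epi (res B) j)) \o
   (val : {additive ker (fmap F (res_mono (res B) j.+1)) -> F (Sigma (res B) j.+1)})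
   : {additive substabF j.+1 B -> satelliteS j B}).
by move=> M N f x; apply: esym; exact: satellite_mapE.
Defined.

Section SatelliteToDerived.
Variables (i : nat) (B : lmodType R).

Fact mono_diff0 (x : F (Sigma (res B) i)) :
  fmap F (res_diff (res B) i) (fmap F (res_mono (res B) i) x) = 0.
Proof.
rewrite -fmap_comp; apply: fmap0 => y /=.
by rewrite -res_mono_epi res_epi_mono raddf0.
Qed.

Definition mono_class : {additive F (Sigma (res B) i) -> derived_obj i B} :=
  derived_class i B \o corestr mono_diff0.
End SatelliteToDerived.

Fact mono_class_epi j B x :
  x \in im_pred (fmap F (res_epi (res B) j)) -> mono_class j.+1 B x = 0.
Proof.
move=> /im_predP[y <-]; apply/subq_class_eq0/im_predP; exists y.
by apply: esym; apply: fmap_im => z; rewrite res_mono_epi.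
Qed.

Lemma mono_class_natural i (M N : lmodType R) (f : {linear M -> N}) x :
  mono_class i N (fmap F (cmp_sig (lft f) i) x) = derived_map i f (mono_class i M x).
Proof.
rewrite (derived_mapE f); congr (derived_class _ _ _); apply: val_inj.
by apply: fmap_sqr => y; rewrite cmp_mono.
Qed.

Definition satellite_lift j B :
    {additive coker (fmap F (res_epi (res B) j)) -> derived_obj j.+1 B} :=
  coker_lift (@mono_class_epi j B).

Lemma satellite_liftE j B y : satellite_lift j B (coker_proj _ y) = mono_class j.+1 B y.
Proof. exact: (coker_liftE (@mono_class_epi j B)). Qed.

Definition satellite_to_derived (i : nat) : natTrans (satelliteF i) (derivedF i).
Proof.
case: i => [|j].
  exists (fun B => mono_class 0 B : {additive F B -> derived_obj 0 B}) => M N f x.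
  change (mono_class 0 N (fmap F f x) = derived_map 0 f (mono_class 0 M x)).
  rewrite -(mono_class_natural (i := 0) f x); apply: (congr1 (mono_class 0 N)).
  exact: esym (@fmap_ext _ F _ _ (cmp_sig (lft f) 0) f (cmp_sig0 (lft f)) x).
exists (satellite_lift j) => M N f x; have [y <-] := coker_surj x.
change (satellite_lift j N (satellite_map j f (coker_proj _ y)) =
  derived_map j.+1 f (satellite_lift j M (coker_proj _ y))).
rewrite (satellite_mapE f) !satellite_liftE; exact: mono_class_natural.
Defined.

Section DerivedToSubstab.
Variables (i : nat) (B : lmodType R).

Fact epi_ker (x : F (res B i)) : fmap F (res_diff (res B) i) x = 0 ->
  fmap F (res_mono (res B) i.+1) (fmap F (res_epi (res B) i) x) = 0.
Proof. by move=> <-; apply: fmap_im => y; rewrite res_mono_epi. Qed.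

Fact fmap_epi_cobd (y : F (res B i)) :
  y \in cobd F (res B) i -> fmap F (res_epi (res B) i) y = 0.
Proof.
case: i y => [|j] y; first by move=> /eqP ->; exact: raddf0.
move=> /im_predP[z <-]; rewrite -fmap_comp; apply: fmap0 => t /=.
by rewrite -res_mono_epi res_epi_mono.
Qed.

Fact epi_cobd (x : ker (fmap F (res_diff (res B) i))) :
  val x \in cobd F (res B) i -> ker_map epi_ker x = 0.
Proof. by move=> xI; apply: val_inj; exact: fmap_epi_cobd. Qed.

Definition epi_map : {additive derived_obj i B ->
  ker (fmap F (res_mono (res B) i.+1))} := subq_lift epi_cobd.

Lemma epi_mapE x : epi_map (derived_class i B x) = ker_map epi_ker x.
Proof. exact: (subq_liftE epi_cobd). Qed.
End DerivedToSubstab.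

Definition derived_to_substab (i : nat) : natTrans (derivedF i) (substabF i.+1).
Proof.
exists (epi_map i) => M N f x; have [y <-] := derived_surj x.
change (epi_map i N (derived_map i f (derived_class i M y)) =
  fmap (substabF i.+1) f (epi_map i M (derived_class i M y))).
rewrite (derived_mapE f) !epi_mapE; apply: val_inj.
by apply: fmap_sqr => z; rewrite cmp_epi.
Defined.

End FundamentalSequence.

(* A sequence of functors 0 -> K_0 -> S_0 -> E_0 -> K_1 -> S_1 -> E_1 -> K_2 -> ... *)
Record longSeq (R : pzRingType) := LongSeq {
  lsK : nat -> addFunctor R;
  lsS : nat -> addFunctor R;
  lsE : nat -> addFunctor R;
  lsKS : forall i : nat, natTrans (lsK i) (lsS i);
  lsSE : forall i : nat, natTrans (lsS i) (lsE i);
  lsEK : forall i : nat, natTrans (lsE i) (lsK i.+1)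
}.

Definition exact_at_K (R : pzRingType) (L : longSeq R) :=
  nt_mono (lsKS L 0) /\ forall i : nat, nt_exact (lsEK L i) (lsKS L i.+1).
Definition exact_at_S (R : pzRingType) (L : longSeq R) :=
  forall i : nat, nt_exact (lsKS L i) (lsSE L i).
Definition exact_at_E (R : pzRingType) (L : longSeq R) :=
  forall i : nat, nt_exact (lsSE L i) (lsEK L i).

Definition right_fundamental_seq (R : pzRingType)
    (res : forall B : lmodType R, injRes B) (F : addFunctor R) : longSeq R :=
  LongSeq (substab_to_satellite res F) (satellite_to_derived res F)
          (derived_to_substab res F).

(* The sequence obtained by replacing each E_i by an isomorphic functor. *)
Definition replace_E (R : pzRingType) (L : longSeq R) (E : nat -> addFunctor R)
    (phi : forall i : nat, natIso (lsE L i) (E i)) : longSeq R :=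
  LongSeq (lsKS L) (fun i => nt_comp (iso_to (phi i)) (lsSE L i))
          (fun i => nt_comp (lsEK L i) (iso_from (phi i))).

Definition substabilization (R : pzRingType)
    (res : forall B : lmodType R, injRes B) (F : addFunctor R) : addFunctor R :=
  substabF res F 0.

(* Ext^i(A, -) is the right derived functor R^i of Hom(A, -), with Ext^0 = Hom. *)
Definition ExtF (R : pzRingType) (res : forall B : lmodType R, injRes B)
    (A : lmodType R) (i : nat) : addFunctor R :=
  match i with 0 => homF A | j.+1 => derivedF res (homF A) j.+1 end.

(* Main.v *)
Require Import Defs.
From HB Require Import structures.
From mathcomp Require Import all_boot all_order all_algebra.
From mathcomp Require Import boolp.

Import GRing.Theory.
Local Open Scope ring_scope.

Set Implicit Arguments.
Unset Strict Implicit.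
Unset Printing Implicit Defensive.

(** Restricting a cocycle to the cycles of [C] gives a natural transformation
    from [H^n(C, -)] to [Hom(H_n(C), -)] which is bijective on injective modules:
    maps extend from the cycles to [C_n], and a cocycle that vanishes on the
    cycles factors through [d_n], hence extends to [C_(n-1)]. Right derived
    functors see only the values on injectives, so [R^i H^n(C, -)] is
    [R^i Hom(H_n(C), -)]. Exactness of the right fundamental sequence away from
    the derived functors holds for every additive functor; at [R^i F] it amounts
    to exactness of [F] on [0 -> Sigma^i B -> I^i -> Sigma^(i+1) B -> 0].
    The map onto the sub-stabilization sends [g] to the class of [g o d_n]. *)

(** * Factoring a linear map through another *)

Section LinearFactorization.
Variables (R : pzRingType) (U V W : lmodType R).
Variables (p : {linear U -> V}) (x : {linear U -> W}).
Hypothesis px : forall u, p u = 0 -> x u = 0.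

(** A set-theoretic section [s] of [p] suffices: [px] makes [x] depend only on the value of [p], so
    [x \o s] is linear although [s] need not be. *)
Lemma linear_factor_surj : (forall v, exists u, p u = v) ->
  exists g : {linear V -> W}, forall u, g (p u) = x u.
Proof.
move=> p_surj.
pose s v := projT1 (cid (p_surj v)).
have sP v : p (s v) = v by rewrite /s; case: cid.
have eqx u u' : p u = p u' -> x u = x u'.
  by move=> e; apply: subr0_eq; rewrite -linearB; apply: px; rewrite linearB e subrr.
have lin : linear (x \o s).
  by move=> a v v'; rewrite /= -linearP; apply: eqx; rewrite linearP !sP.
pose L := GRing.isLinear.Build R V W *:%R (x \o s) lin.
by exists (HB.pack (x \o s) L : {linear V -> W}) => u /=; apply: eqx; rewrite sP.
Qed.

(** Modulo the kernel of [p], the map [p] becomes a monomorphism into [V] and [x] still descends;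
    injectivity of [W] then extends [x] from the image of [p] to all of [V]. *)
Lemma linear_factor_injective : injective_module W ->
  exists g : {linear V -> W}, forall u, g (p u) = x u.
Proof.
move=> injW.
have p0 u : u \in ker_pred p -> p u = 0 by move/ker_predP.
have x0 u : u \in ker_pred p -> x u = 0 by move/ker_predP/px.
have pinj : injective (quotmod_lift p0).
  apply: raddf_inj => v; have [u <-] := quotmod_surj v.
  move=> e; apply/quotmod_proj_eq0/ker_predP; rewrite -e.
  exact/esym/quotmod_liftE.
have [g gP] := injW _ _ (quotmod_lift p0 : {linear _ -> _})
  (quotmod_lift x0 : {linear _ -> _}) pinj.
exists g => u; rewrite -(quotmod_liftE p0) -(quotmod_liftE x0); exact: gP.
Qed.
End LinearFactorization.

(** * Natural isomorphisms from bijective natural transformations *)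

Section NatIsoConstructions.
Variable R : pzRingType.

Section OfBijection.
Variables (F G : addFunctor R) (a : natTrans F G).
Hypotheses (a_mono : nt_mono a) (a_epi : nt_epi a).

Definition nt_inv_fun M (y : G M) : F M := projT1 (cid (a_epi y)).
Lemma nt_inv_funK M (y : G M) : a M (nt_inv_fun y) = y.
Proof. by rewrite /nt_inv_fun; case: cid. Qed.
Fact nt_inv_fun_additive M : zmod_morphism (@nt_inv_fun M).
Proof. by move=> y z; apply: a_mono; rewrite raddfB !nt_inv_funK. Qed.
HB.instance Definition _ M :=
  GRing.isZmodMorphism.Build (G M) (F M) (@nt_inv_fun M) (@nt_inv_fun_additive M).

Definition nt_inv : natTrans G F.
Proof.
exists (fun M => @nt_inv_fun M : {additive G M -> F M}) => M N f y.
by apply: a_mono; rewrite nt_natural /= !nt_inv_funK.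
Defined.

Definition natIso_of_bij : natIso F G.
Proof.
exists a nt_inv => M y; last exact: nt_inv_funK.
by apply: a_mono; rewrite nt_inv_funK.
Defined.
End OfBijection.

Definition natIso_sym (F G : addFunctor R) (e : natIso F G) : natIso G F :=
  NatIso (@iso_fromK _ _ _ e) (@iso_toK _ _ _ e).

Definition natIso_trans (F G H : addFunctor R) (e : natIso F G) (e' : natIso G H) :
  natIso F H.
Proof.
exists (nt_comp (iso_to e') (iso_to e)) (nt_comp (iso_from e) (iso_from e')) => M x /=.
  by rewrite !iso_toK.
by rewrite !iso_fromK.
Defined.
End NatIsoConstructions.

(** * Right derived functors depend only on values at injectives *)

Section DerivedTransformation.
Variables (R : pzRingType) (res : forall B : lmodType R, injRes B).
Variables (F G : addFunctor R) (a : natTrans F G).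

Lemma nt_ker (M N : lmodType R) (f : {linear M -> N}) (x : F M) :
  fmap F f x = 0 -> fmap G f (a M x) = 0.
Proof. by move=> x0; rewrite -nt_natural x0 raddf0. Qed.

Lemma nt_cobd (B : lmodType R) (I : injRes B) i (x : F (I i)) :
  x \in cobd F I i -> a (I i) x \in cobd G I i.
Proof.
case: i x => [|i] x; first by move=> /eqP ->; rewrite raddf0 rpred0.
by move=> /im_predP[y <-]; apply/im_predP; exists (a _ y); rewrite nt_natural.
Qed.

Definition derived_trans_map (i : nat) (B : lmodType R) :
    {additive derived_obj res F i B -> derived_obj res G i B} :=
  subq_map (@nt_ker _ _ (res_diff (res B) i)) (@nt_cobd B (res B) i).

Lemma derived_trans_mapE i B x : derived_trans_map i B (derived_class res F i B x) =
  derived_class res G i B (ker_map (@nt_ker _ _ (res_diff (res B) i)) x).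
Proof. exact: subq_mapE. Qed.

Definition derived_trans (i : nat) : natTrans (derivedF res F i) (derivedF res G i).
Proof.
exists (derived_trans_map i) => M N f x; have [y <-] := derived_surj x.
change (derived_trans_map i N (derived_map res F i f (derived_class res F i M y)) =
  derived_map res G i f (derived_trans_map i M (derived_class res F i M y))).
rewrite derived_mapE !derived_trans_mapE derived_mapE.
congr (derived_class _ _ _ _ _); apply: val_inj; exact: nt_natural.
Defined.

Hypothesis a_inj : forall E, injective_module E -> injective (a E).
Hypothesis a_surj : forall E, injective_module E -> forall y, exists x, a E x = y.

Lemma derived_trans_mono i : nt_mono (derived_trans i).
Proof.
move=> B; apply: raddf_inj => x; have [y <-] := derived_surj x.
move=> /(etrans (esym (derived_trans_mapE _))) /subq_class_eq0 /= yG.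
(* In degree 0 the coboundaries are zero and injectivity on [I^0] is enough. In degree [i.+1] the
   bounding cochain is lifted by surjectivity on [I^i], and injectivity on [I^(i+1)] shows that the
   lift bounds. *)
apply/subq_class_eq0; case: i x y yG => [|i] x y.
  move=> /eqP y0; apply/eqP; apply: (a_inj (@res_injective _ _ (res B) 0)).
  by rewrite y0 raddf0.
move=> /im_predP[z]; have [z' <-] := a_surj (@res_injective _ _ (res B) i) z.
rewrite -nt_natural => /(a_inj (@res_injective _ _ (res B) _)) e.
by apply/im_predP; exists z'.
Qed.

Lemma derived_trans_epi i : nt_epi (derived_trans i).
Proof.
move=> B y; have [z <-] := derived_surj y.
have [x xz] := a_surj (@res_injective _ _ (res B) i) (val z).
(* The lift of a cocycle is again a cocycle because [a] is injective one degree higher. *)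
have x0 : fmap F (res_diff (res B) i) x = 0.
  apply: (a_inj (@res_injective _ _ (res B) _)).
  by rewrite nt_natural xz kerP raddf0.
exists (derived_class _ _ _ B (toker x0)).
apply: etrans (derived_trans_mapE _) _.
congr (derived_class _ _ _ _ _); exact: val_inj.
Qed.

Definition derived_iso i : natIso (derivedF res F i) (derivedF res G i) :=
  natIso_of_bij (@derived_trans_mono i) (@derived_trans_epi i).
End DerivedTransformation.

(** * Left exactness of Hom and its zeroth derived functor *)

Section HomFunctor.
Variables (R : pzRingType) (A : lmodType R).

Lemma hom_ext (M : lmodType R) (f g : Defs.hom A M) :
  f = g <-> (f : {linear A -> M}) =1 (g : {linear A -> M}).
Proof. by split=> [-> //|]; exact: linear_ext. Qed.

(** Since [m] is injective, the pointwise preimages are unique, which forces the chosen ones to be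
    linear in [a]. *)
Lemma hom_lift_kernel (K M N : lmodType R) (m : {linear K -> M}) (d : {linear M -> N})
    (f : {linear A -> M}) :
  injective m -> (forall y, d y = 0 -> exists x, m x = y) ->
  (forall a, d (f a) = 0) -> exists g : {linear A -> K}, forall a, m (g a) = f a.
Proof.
move=> m_inj mP df0; pose g a := projT1 (cid (mP _ (df0 a))).
have gP a : m (g a) = f a by rewrite /g; case: cid.
have lin : linear g by move=> c u v; apply: m_inj; rewrite linearP !gP linearP.
pose L := GRing.isLinear.Build R A K *:%R g lin.
by exists (HB.pack g L : {linear A -> K}).
Qed.

Variable res : forall B : lmodType R, injRes B.

(** By left exactness, the map from [F] to [R^0 F] in the fundamental sequence is already bijective
    for [F = Hom(A, -)]; the isomorphism is its inverse. *)
Definition derived0_hom_iso : natIso (derivedF res (homF A) 0) (homF A).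
Proof.
apply/natIso_sym/(@natIso_of_bij _ _ _ (satellite_to_derived res (homF A) 0)) => B.
  apply: raddf_inj => x /subq_class_eq0/eqP/hom_ext x0.
  apply/hom_ext => a; apply: (@res_mono_inj _ _ (res B) 0).
  by rewrite [RHS]raddf0; exact: x0.
move=> y; have [z <-] := derived_surj y.
have /hom_ext z0 := kerP z.
have [g gP] := hom_lift_kernel (@res_aug_inj _ _ (res B))
  (fun y => proj1 (@res_exact0 _ _ (res B) y)) z0.
exists (g : Defs.hom A B); congr subq_class; apply: val_inj; exact/hom_ext.
Defined.
End HomFunctor.

(** * Exactness of the right fundamental sequence of an additive functor *)

Section FundamentalExactness.
Variables (R : pzRingType) (res : forall B : lmodType R, injRes B).
Variable F : addFunctor R.
Let L := right_fundamental_seq res F.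

Lemma right_fundamental_exact_at_K : exact_at_K L.
Proof.
split=> [B x y|i B y]; first exact: val_inj.
split=> [|[x <-]].
  move=> /coker_proj_eq0/im_predP[x xy].
  (* The element [y] of [Ker F(m_(i+1))] equals [F(e_i) x], and [F(d^i) = F(m_(i+1)) F(e_i)], so [x]
     is a cocycle. *)
  have x0 : fmap F (res_diff (res B) i) x = 0.
    by rewrite -(kerP y) -xy; apply/esym/fmap_im => z; rewrite res_mono_epi.
  exists (derived_class _ _ _ B (toker x0)); apply: etrans (epi_mapE _) _.
  exact: val_inj.
have [z <-] := derived_surj x.
apply: etrans (congr1 (lsKS L i.+1 B) (epi_mapE z)) _.
by apply/coker_proj_eq0/im_predP; exists (val z).
Qed.

Lemma right_fundamental_exact_at_S : exact_at_S L.
Proof.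
case=> [|i] B y.
  split=> [/subq_class_eq0/eqP y0|[x <-]]; first by exists (@toker _ _ (fmap F (res_mono (res B) 0)) y y0).
  by apply/subq_class_eq0/eqP; exact: kerP.
have [z <-] := coker_surj y; split=> [|[x <-]]; last first.
  apply: etrans (satellite_liftE _) _; apply/subq_class_eq0.
  by rewrite /= kerP rpred0.
move=> /(etrans (esym (satellite_liftE _)))/subq_class_eq0/im_predP[w wz].
(* Here [F(m_(i+1)) z = F(d^i) w]. Subtracting [F(e_i) w] keeps the class of [z] in the cokernel and
   moves the representative into [Ker F(m_(i+1))]. *)
have z0 : fmap F (res_mono (res B) i.+1) (z - fmap F (res_epi (res B) i) w) = 0.
  rewrite raddfB (fmap_im (h := res_diff (res B) i)) ?wz ?subrr //.
  exact: res_mono_epi.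
exists (@toker _ _ (fmap F (res_mono (res B) i.+1)) _ z0); apply/coker_proj_eq; apply/im_predP; exists (- w).
by rewrite raddfN /= addrAC subrr add0r.
Qed.

Lemma right_fundamental_exact_at_E : half_exact F -> exact_at_E L.
Proof.
move=> hF i B y; have [z <-] := derived_surj y.
split=> [|[x <-]].
  move=> /(etrans (esym (epi_mapE _)))/(congr1 val) /= z0.
  (* Half-exactness is applied to the short exact sequence of [m_i] and [e_i], as [F(e_i)] kills the
     cocycle [z]. *)
  have [w wz] : exists w, fmap F (res_mono (res B) i) w = val z.
    apply/(hF _ _ _ (res_mono (res B) i) (res_epi (res B) i)) => //.
    - exact: res_mono_inj.
    - move=> u; split=> [/quotmod_proj_eq0/im_predP //|[v <-]].
      exact: res_epi_mono.
    - exact: res_epi_surj.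
  have e : mono_class res F i B w = derived_class res F i B z.
    by congr subq_class; apply: val_inj.
  (* [S^0 F] is [F] itself, whereas a higher satellite is a cokernel, so there the preimage is the
     class of [w]. *)
  by case: i z y w wz e z0 => [|i] z y w wz e _;
    [exists w|exists (coker_proj _ w); apply: etrans (satellite_liftE _) _].
have D w : epi_map res F i B (mono_class res F i B w) = 0.
  rewrite epi_mapE; apply: val_inj; rewrite /= -fmap_comp.
  by apply: fmap0 => u /=; rewrite res_epi_mono.
case: i z y x D => [|i] z y x D; first exact: D.
have [w <-] := coker_surj x.
by apply: etrans (D w); congr (epi_map _ _ _ _ _); exact: satellite_liftE.
Qed.
End FundamentalExactness.

(** * Exactness is preserved by isomorphic replacement of the terms [E_i] *)

Section ReplaceExactness.
Variables (R : pzRingType) (L : longSeq R) (E : nat -> addFunctor R).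
Variable phi : forall i : nat, natIso (lsE L i) (E i).

Lemma replace_E_exact_at_K : exact_at_K L -> exact_at_K (replace_E phi).
Proof.
case=> mL eL; split=> // i B y; split=> [/eL[x <-]|[x <-]].
  by exists (iso_to (phi i) B x); rewrite /= iso_toK.
by apply/eL; exists (iso_from (phi i) B x).
Qed.

Lemma replace_E_exact_at_S : exact_at_S L -> exact_at_S (replace_E phi).
Proof.
move=> eL i B y; split=> [|/eL/= ->]; last exact: raddf0.
by rewrite /= -[RHS](raddf0 (iso_to (phi i) B)) => /(can_inj (iso_toK _ (M := B)))/eL.
Qed.

Lemma replace_E_exact_at_E : exact_at_E L -> exact_at_E (replace_E phi).
Proof.
move=> eL i B y; split=> [/eL[x xy]|[x <-]].
  by exists x; rewrite /= xy iso_fromK.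
by rewrite /= iso_toK; apply/eL; exists x.
Qed.
End ReplaceExactness.

(** * Comparison of cohomology with Hom out of homology *)

Section CohomologyToHom.
Variables (R : pzRingType) (C : complex R) (n : int).

Section Map.
Variable M : lmodType R.

Definition on_cycles (x : Defs.hom (C n) M) :
    {linear submod (ker_pred (diff C n (n - 1))) -> M} :=
  (x : {linear C n -> M}) \o @submod_incl _ _ _.

Fact on_cycles_boundaries (x : ker (@precomp _ _ _ M (diff C (n + 1) n))) z :
  z \in @im_in_ker_pred _ _ _ _ (diff C (n + 1) n) (diff C n (n - 1)) -> on_cycles (val x) z = 0.
Proof.
by move=> /im_predP[u uz]; have /hom_ext/(_ u) := kerP x; rewrite /= uz.
Qed.

Definition on_homology (x : ker (@precomp _ _ _ M (diff C (n + 1) n))) :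
  Defs.hom (homologyC C n) M := quotmod_lift (@on_cycles_boundaries x).

Lemma on_homologyE x z :
  (on_homology x : {linear _ -> _}) (quotmod_proj _ z) = on_cycles (val x) z.
Proof. exact: quotmod_liftE. Qed.

Fact on_homology_additive : zmod_morphism on_homology.
Proof.
move=> x y; apply/hom_ext => h; have [z <-] := quotmod_surj h.
apply: etrans (on_homologyE _ _) _.
by apply: esym; congr (_ - _); exact: on_homologyE.
Qed.
HB.instance Definition _ :=
  GRing.isZmodMorphism.Build _ _ on_homology on_homology_additive.

Fact on_homology_coboundary x :
  val x \in im_pred (@precomp _ _ _ M (diff C n (n - 1))) -> on_homology x = 0.
Proof.
move=> /im_predP[y /hom_ext yx]; apply/hom_ext => h; have [z <-] := quotmod_surj h.
apply: etrans (on_homologyE _ _) _; apply: etrans (esym (yx _)) _ => /=.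
by have /ker_predP -> := valP z; exact: raddf0.
Qed.

Definition cohom_to_hom_map : {additive cohomF C n M -> homF (homologyC C n) M} :=
  subq_lift on_homology_coboundary.

Lemma cohom_to_hom_mapE x : cohom_to_hom_map (subq_class _ x) = on_homology x.
Proof. exact: subq_liftE. Qed.

(** A cocycle with zero restriction vanishes on the kernel of [d_n]; it therefore factors through
    [d_n] by a map defined on all of [C (n - 1)], and is a coboundary. *)
Lemma cohom_to_hom_inj : injective_module M -> injective cohom_to_hom_map.
Proof.
move=> injM; apply: raddf_inj => h; have [x <-] := subq_surj h.
rewrite cohom_to_hom_mapE => /hom_ext x0; apply/subq_class_eq0/im_predP.
have xz z : diff C n (n - 1) z = 0 -> (val x : {linear _ -> _}) z = 0.
  move=> /(introT (ker_predP _ _)) zP.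
  by apply: etrans (x0 (quotmod_proj _ (Sub z zP))); apply/esym/on_homologyE.
have [g gP] := linear_factor_injective xz injM.
by exists (g : Defs.hom _ _); apply/hom_ext.
Qed.

(** The map [y] is pulled back to the cycles and extended to [C n]; the extension is a cocycle
    because boundaries have zero homology class. *)
Lemma cohom_to_hom_surj : injective_module M ->
  forall y, exists x, cohom_to_hom_map x = y.
Proof.
move=> injM y.
have [x xP] := injM _ _ (@submod_incl _ _ (ker_pred (diff C n (n - 1))) : {linear _ -> _})
  ((y : {linear _ -> _}) \o @quotmod_proj _ _ _ : {linear _ -> _}) val_inj.
have x0 : precomp (diff C (n + 1) n) (x : Defs.hom (C n) M) = 0.
  apply/hom_ext => u /=.
  have uP : diff C (n + 1) n u \in ker_pred (diff C n (n - 1)).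
    by apply/ker_predP; exact: diff_diff.
  pose w : submod (ker_pred (diff C n (n - 1))) := Sub (diff C (n + 1) n u) uP.
  apply: etrans (xP w) _ => /=.
  rewrite (proj2 (quotmod_proj_eq0 _ _)) ?raddf0 //.
  by apply/im_predP; exists u.
exists (subq_class _ (toker x0)); rewrite cohom_to_hom_mapE.
apply/hom_ext => h; have [z <-] := quotmod_surj h.
exact: etrans (on_homologyE (toker x0) z) (xP z).
Qed.
End Map.

Definition cohom_to_hom : natTrans (cohomF C n) (homF (homologyC C n)).
Proof.
exists cohom_to_hom_map => M N f h; have [x <-] := subq_surj h.
apply: etrans (congr1 (cohom_to_hom_map N) (subq_mapE _ _ _)) _.
rewrite !cohom_to_hom_mapE.
apply/hom_ext => c; have [z <-] := quotmod_surj c.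
apply: etrans (on_homologyE _ _) _.
by apply: esym; apply: etrans (congr1 f (on_homologyE _ _)) _.
Defined.

Variable res : forall B : lmodType R, injRes B.

Definition derived_cohom_Ext_iso i :
  natIso (derivedF res (cohomF C n) i) (ExtF res (homologyC C n) i).
Proof.
have e := derived_iso res (a := cohom_to_hom) cohom_to_hom_inj cohom_to_hom_surj.
(* [ExtF] is Hom by definition in degree 0, so the identification of [R^0 Hom] with Hom is needed
   there. *)
case: i => [|i]; last exact: e.
exact: natIso_trans (e 0) (derived0_hom_iso _ _).
Defined.
End CohomologyToHom.

(** * The sub-stabilization of cohomology as a quotient of Hom out of the boundaries *)

Section Substabilization.
Variables (R : pzRingType) (C : complex R) (n : int).

Fact diff_boundary x : diff C n (n - 1) x \in im_pred (diff C (n - 1 + 1) (n - 1)).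
Proof.
(* The degrees [n - 1 + 1] and [n] are equal but not convertible; generalizing the source degree
   avoids a cast. *)
have H m : m = n -> diff C n (n - 1) x \in im_pred (diff C m (n - 1)).
  by move=> ->; exact: im_predT.
exact: H (subrK 1 n).
Qed.

Definition to_boundaries (x : C n) : boundaries C (n - 1) :=
  Sub (diff C n (n - 1) x) (diff_boundary x).

Fact to_boundaries_linear : linear to_boundaries.
Proof. by move=> a x y; apply: val_inj; rewrite /= linearP. Qed.
HB.instance Definition _ :=
  GRing.isLinear.Build R (C n) (boundaries C (n - 1)) *:%R
    to_boundaries to_boundaries_linear.

Lemma to_boundaries_surj y : exists x, to_boundaries x = y.
Proof.
have /im_predP[x xy] := valP y.
have [x' e] : exists x', diff C n (n - 1) x' = val y.
  by rewrite -xy; move: x {xy}; rewrite subrK => x; exists x.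
by exists x'; apply: val_inj.
Qed.

Lemma to_boundaries_eq0 x : to_boundaries x = 0 <-> diff C n (n - 1) x = 0.
Proof. by split=> [/(congr1 val)|e] //; apply: val_inj. Qed.

Section Map.
Variable M : lmodType R.

Fact precomp_to_boundaries_ker (g : Defs.hom (boundaries C (n - 1)) M) :
  precomp (diff C (n + 1) n) (precomp to_boundaries g) = 0.
Proof.
apply/hom_ext => u /=.
by rewrite (proj2 (to_boundaries_eq0 _)) ?raddf0 ?diff_diff.
Qed.

Definition boundary_class : {additive Defs.hom (boundaries C (n - 1)) M -> cohomF C n M} :=
  @subq_class _ _ _ (im_pred (@precomp _ _ _ M (diff C n (n - 1)))) \o
  corestr precomp_to_boundaries_ker.

(** Because [d_n] maps onto the boundaries, [h] and [g] agree after composition with [d_n] exactly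
    when [h] extends [g]. *)
Lemma boundary_class_eq0 g : boundary_class g = 0 <->
  exists h : Defs.hom (C (n - 1)) M, precomp (boundaries_incl C (n - 1)) h = g.
Proof.
split=> [/subq_class_eq0/im_predP[h /hom_ext e]|[h <-]].
  exists h; apply/hom_ext => y; have [x <-] := to_boundaries_surj y.
  exact: e.
by apply/subq_class_eq0/im_predP; exists h; apply/hom_ext.
Qed.
End Map.

Lemma boundary_class_natural (M N : lmodType R) (f : {linear M -> N}) g :
  boundary_class N (postcomp f g) = fmap (cohomF C n) f (boundary_class M g).
Proof.
apply: esym; apply: etrans (subq_mapE _ _ _) _.
by congr subq_class; apply: val_inj; apply/hom_ext.
Qed.

(** In [E] the map [m \o g] extends from the boundaries to [C (n - 1)], so its class is that of a
    coboundary. Hence boundary classes lie in the sub-stabilization. *)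
Lemma boundary_class_killed (M E : lmodType R) (m : {linear M -> E}) g :
  injective_module E -> fmap (cohomF C n) m (boundary_class M g) = 0.
Proof.
move=> injE; rewrite -boundary_class_natural; apply/boundary_class_eq0.
have [h hP] := injE _ _ (boundaries_incl C (n - 1)) (postcomp m g : {linear _ -> _}) val_inj.
by exists h; apply/hom_ext.
Qed.

(** If [m] sends a cocycle to a coboundary, then by injectivity of [m] the cocycle vanishes on the
    kernel of [d_n], so it factors through the boundaries. *)
Lemma boundary_class_surj (M E : lmodType R) (m : {linear M -> E}) y :
  injective m -> fmap (cohomF C n) m y = 0 -> exists g, boundary_class M g = y.
Proof.
move=> m_inj; have [x <-] := subq_surj y.
move=> /(etrans (esym (subq_mapE _ _ _)))/subq_class_eq0/im_predP[h /hom_ext hP].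
have x0 c : to_boundaries c = 0 -> (val x : {linear _ -> _}) c = 0.
  move=> /to_boundaries_eq0 c0; apply: m_inj.
  by apply: etrans (esym (hP c)) _; rewrite /= c0 !raddf0.
have [g gP] := linear_factor_surj x0 to_boundaries_surj.
exists (g : Defs.hom _ _); congr subq_class; apply: val_inj; exact/hom_ext.
Qed.

Variable res : forall B : lmodType R, injRes B.

Definition boundary_to_substab :
  natTrans (homF (boundaries C (n - 1))) (substabilization res (cohomF C n)).
Proof.
exists (fun M => corestr (g := fmap (cohomF C n) (res_mono (res M) 0))
  (fun g => boundary_class_killed (res_mono (res M) 0) g (@res_injective _ _ (res M) 0))
  : {additive _ -> substabilization res (cohomF C n) M}).
move=> M N f g; apply: val_inj; exact: boundary_class_natural.
Defined.

Lemma boundary_to_substab_epi : nt_epi boundary_to_substab.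
Proof.
move=> M y.
have [g gy] := boundary_class_surj (@res_mono_inj _ _ (res M) 0) (kerP y).
by exists g; apply: val_inj.
Qed.

Lemma boundary_to_substab_exact :
  nt_exact (homF_map (boundaries_incl C (n - 1))) boundary_to_substab.
Proof.
move=> M g; split=> [/(congr1 val)/boundary_class_eq0 //|/boundary_class_eq0 g0].
exact: val_inj.
Qed.
End Substabilization.

(** * Contravariant left exactness of Hom *)

Section HomLeftExact.
Variables (R : pzRingType) (A B D : lmodType R).
Variables (i : {linear A -> B}) (p : {linear B -> D}).
Hypothesis p_surj : forall y, exists x, p x = y.

Lemma homF_map_mono : nt_mono (homF_map p).
Proof.
move=> M f g /hom_ext fg; apply/hom_ext => y.
by have [x <-] := p_surj y; exact: fg.
Qed.

Lemma homF_map_exact : (forall x, p x = 0 <-> exists a, i a = x) ->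
  nt_exact (homF_map p) (homF_map i).
Proof.
move=> ip M f; split=> [/hom_ext f0|[g <-]]; last first.
  apply/hom_ext => a /=; rewrite (proj2 (ip (i a))) ?raddf0 //.
  by exists a.
have fp x : p x = 0 -> (f : {linear _ -> _}) x = 0 by move=> /ip[a <-]; exact: f0.
have [g gP] := linear_factor_surj fp p_surj.
by exists g; apply/hom_ext.
Qed.
End HomLeftExact.

Theorem mainTheorem5 (R : pzRingType) (C : complex R) (n : int)
    (res : forall B : lmodType R, injRes B) :
  let F := cohomF C n in
  (exists phi : forall i : nat,
      natIso (derivedF res F i) (ExtF res (homologyC C n) i),
    let L := replace_E (L := right_fundamental_seq res F) phi in
    exact_at_K L /\ exact_at_S L /\ (half_exact F -> exact_at_E L))
  /\
  (exists delta : natTrans (homF (boundaries C (n - 1))) (substabilization res F),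
    nt_mono (homF_map (mod_boundaries_proj C (n - 1))) /\
    nt_exact (homF_map (mod_boundaries_proj C (n - 1)))
             (homF_map (boundaries_incl C (n - 1))) /\
    nt_exact (homF_map (boundaries_incl C (n - 1))) delta /\
    nt_epi delta).
Proof.
move=> F; split.
  exists (derived_cohom_Ext_iso C n res); split; [|split=> [|hF]].
  - exact/replace_E_exact_at_K/right_fundamental_exact_at_K.
  - exact/replace_E_exact_at_S/right_fundamental_exact_at_S.
  - exact/replace_E_exact_at_E/right_fundamental_exact_at_E.
have p_surj : forall y, exists x, mod_boundaries_proj C (n - 1) x = y.
  exact: quotmod_surj.
exists (boundary_to_substab C n res); split; [|split; [|split]].
- exact: homF_map_mono.
- apply: homF_map_exact => // x; split=> [/quotmod_proj_eq0 xB|[b <-]].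
    by exists (Sub x xB).
  by apply/quotmod_proj_eq0; exact: valP.
- exact: boundary_to_substab_exact.
- exact: boundary_to_substab_epi.
Qed.
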